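(* Let $D$ be any orientation of a $7$-cycle (i.e.\ $D$ is isomorphic to one of $D_1,\dots,D_{10}$) and let $v\geq 7$ be an integer. There exists a $D$-decomposition of $K^*_v$ if and only if $v\equiv 0$ or $1 \pmod 7$.
   Context: $K^*_v$ denotes the complete symmetric digraph of order $v$: it has $v$ vertices and contains both arcs $(x,y)$ and $(y,x)$ for every pair of distinct vertices $x,y$. A $D$-decomposition of a digraph $K$ is a set of subdigraphs of $K$, each isomorphic to $D$, such that every arc of $K$ lies in exactly one of them. For distinct vertices $v_0,\dots,v_6$, the digraphs $D_i[v_0,v_1,\dots,v_6]$ ($i\in[1,10]$) all have vertex set $\{v_0,\dots,v_6\}$ and the following arc sets: $D_1$: $(v_1,v_0),(v_1,v_2),(v_2,v_3),(v_3,v_4),(v_4,v_5),(v_5,v_6),(v_6,v_0)$; $D_2$: $(v_1,v_0),(v_2,v_1),(v_2,v_3),(v_3,v_4),(v_4,v_5),(v_5,v_6),(v_6,v_0)$; $D_3$: $(v_1,v_0),(v_1,v_2),(v_3,v_2),(v_3,v_4),(v_4,v_5),(v_5,v_6),(v_6,v_0)$; $D_4$: $(v_1,v_0),(v_1,v_2),(v_2,v_3),(v_4,v_3),(v_4,v_5),(v_5,v_6),(v_6,v_0)$; $D_5$: $(v_1,v_0),(v_2,v_1),(v_3,v_2),(v_3,v_4),(v_4,v_5),(v_5,v_6),(v_6,v_0)$; $D_6$: $(v_1,v_0),(v_2,v_1),(v_2,v_3),(v_3,v_4),(v_5,v_4),(v_5,v_6),(v_6,v_0)$; $D_7$: $(v_1,v_0),(v_1,v_2),(v_3,v_2),(v_3,v_4),(v_4,v_5),(v_6,v_5),(v_6,v_0)$;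 $D_8$: $(v_1,v_0),(v_2,v_1),(v_2,v_3),(v_4,v_3),(v_4,v_5),(v_5,v_6),(v_6,v_0)$; $D_9$: $(v_1,v_0),(v_2,v_1),(v_2,v_3),(v_3,v_4),(v_4,v_5),(v_6,v_5),(v_6,v_0)$; $D_{10}$: $(v_0,v_1),(v_1,v_2),(v_2,v_3),(v_3,v_4),(v_4,v_5),(v_5,v_6),(v_6,v_0)$. $D_i$ also denotes the isomorphism type of $D_i[v_0,\dots,v_6]$; these ten digraphs are, up to isomorphism, all orientations of a $7$-cycle. *)

(* Defs.v *)
From mathcomp Require Import all_boot all_fingroup.
Set Implicit Arguments. Unset Strict Implicit. Unset Printing Implicit Defensive.

(* Arc lists of D_1..D_10 on vertices v_0..v_6 (encoded as 0..6); (a,b) is the arc (v_a,v_b). *)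
Definition D_arcs_nat (i : nat) : seq (nat * nat) :=
  match i with
  | 1 => [:: (1,0); (1,2); (2,3); (3,4); (4,5); (5,6); (6,0)]
  | 2 => [:: (1,0); (2,1); (2,3); (3,4); (4,5); (5,6); (6,0)]
  | 3 => [:: (1,0); (1,2); (3,2); (3,4); (4,5); (5,6); (6,0)]
  | 4 => [:: (1,0); (1,2); (2,3); (4,3); (4,5); (5,6); (6,0)]
  | 5 => [:: (1,0); (2,1); (3,2); (3,4); (4,5); (5,6); (6,0)]
  | 6 => [:: (1,0); (2,1); (2,3); (3,4); (5,4); (5,6); (6,0)]
  | 7 => [:: (1,0); (1,2); (3,2); (3,4); (4,5); (6,5); (6,0)]
  | 8 => [:: (1,0); (2,1); (2,3); (4,3); (4,5); (5,6); (6,0)]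
  | 9 => [:: (1,0); (2,1); (2,3); (3,4); (4,5); (6,5); (6,0)]
  | 10 => [:: (0,1); (1,2); (2,3); (3,4); (4,5); (5,6); (6,0)]
  | _ => [::]
  end.

Definition D_arcs (i : nat) : {set 'I_7 * 'I_7} :=
  [set a | a \in [seq (@inord 6 p.1, @inord 6 p.2) | p <- D_arcs_nat i]].

Definition digraph_iso7 (A B : {set 'I_7 * 'I_7}) : Prop :=
  exists s : {perm 'I_7}, B = [set (s a.1, s a.2) | a in A].

Definition Kstar_arc (v : nat) (a : 'I_v * 'I_v) : bool := a.1 != a.2.

Definition copy_arcs (v : nat) (D : {set 'I_7 * 'I_7}) (f : {ffun 'I_7 -> 'I_v})
  : {set 'I_v * 'I_v} := [set (f a.1, f a.2) | a in D].

Definition is_decomposition (v : nat) (D : {set 'I_7 * 'I_7})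
  (F : seq {ffun 'I_7 -> 'I_v}) : Prop :=
  (forall f, f \in F -> injective f) /\
  (forall a : 'I_v * 'I_v, Kstar_arc a ->
      count (fun f => a \in copy_arcs D f) F = 1).

Definition has_decomposition (v : nat) (D : {set 'I_7 * 'I_7}) : Prop :=
  exists F : seq {ffun 'I_7 -> 'I_v}, is_decomposition D F.

(* Main.v *)
Require Import Defs.
From mathcomp Require Import all_boot all_fingroup.
From mathcomp Require Import ssralg finalg zmodp zify.

(* Necessity: the v(v-1) arcs are partitioned into classes of size 7, and 7 is prime.

   Sufficiency, for v = 7t or 7t + 1: the orders 7, 8, 14, 15 are given by explicit designs.
   For t >= 3, take an idempotent Latin square z(x,y) of order t and, for each i, a copy of
   D_i in K*_{7,7,7} (parts indexed by x, y, z, each a copy of Z_7) whose seven arcs have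
   pairwise distinct differences, tail to head, modulo 7. Put a copy on each triple
   (x, y, z(x,y)) with x <> y, and translate it by Z_7. An arc of K*_{7,...,7} determines by
   its difference the arc of D_i which it comes from, hence the columns of the Latin square
   its endpoints lie in, hence (x,y), and then the translation. The t holes of size 7,
   extended by the extra point if v = 7t + 1, are filled with decompositions of K*_7 or K*_8. *)

(** * Arc-disjoint packings that exhaust all arcs by counting *)

Lemma card_neq_pairs (T : finType) :
  #|[pred p : T * T | p.1 != p.2]| = #|T| * #|T|.-1.
Proof.
have diag : #|[pred p : T * T | p.1 == p.2]| = #|T|.
  rewrite -(card_codom (f := fun x : T => (x, x))); last by move=> x y [].
  apply: eq_card => -[x y]; rewrite !inE /=.
  apply/eqP/codomP => [-> | [z [-> ->]]] //; by exists y.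
have := cardC [pred p : T * T | p.1 == p.2].
rewrite diag card_prod.
have -> : #|[predC [pred p : T * T | p.1 == p.2]]| =
  #|[pred p : T * T | p.1 != p.2]| by exact: eq_card.
by case: #|T| => [|n] /=; nia.
Qed.

Lemma uniq_map_inj_in (T1 T2 : eqType) (f : T1 -> T2) (s : seq T1) :
  uniq (map f s) -> {in s &, injective f}.
Proof.
move=> us x y hx hy e; have ix := nth_index x hx; have iy := nth_index x hy.
rewrite -ix -iy; congr nth; apply/eqP.
rewrite -(nth_uniq (f x) _ _ us) ?size_map ?index_mem //.
by rewrite !(nth_map x) ?index_mem // ix iy e.
Qed.

(* Pairwise arc-disjointness and the number of blocks already force every arc of K* to be
   covered, see [decomposable_arc]. *)
Definition decomposable (A : seq (nat * nat)) (V : finType) : Prop :=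
  exists (I : finType) (f : I -> nat -> V),
    [/\ forall k, {in gtn 7 &, injective (f k)},
        forall k k' p q, p \in A -> q \in A ->
          f k p.1 = f k' q.1 -> f k p.2 = f k' q.2 -> k = k'
      & #|I| * 7 = #|V| * #|V|.-1].

Definition arcs_ok (A : seq (nat * nat)) : bool :=
  [&& uniq A, size A == 7 & all (fun p => [&& p.1 < 7, p.2 < 7 & p.1 != p.2]) A].

Lemma arcs_ok_bounds A p : arcs_ok A -> p \in A -> [/\ p.1 < 7, p.2 < 7 & p.1 != p.2].
Proof. by case/and3P => _ _ /allP hA /hA /and3P. Qed.

Lemma D_arcs_nat_ok i : 1 <= i <= 10 -> arcs_ok (D_arcs_nat i).
Proof. by do 11 (case: i => [|i] //). Qed.

Lemma decomposable_card (A : seq (nat * nat)) (V W : finType) :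
  arcs_ok A -> #|V| = #|W| -> decomposable A V -> decomposable A W.
Proof.
move=> okA eVW [I [f [finj funiq fcard]]].
pose g (x : V) : W := enum_val (cast_ord eVW (enum_rank x)).
have ginj : injective g.
  by move=> x y /enum_val_inj /cast_ord_inj /enum_rank_inj.
exists I, (fun k j => g (f k j)); split.
- by move=> k x y hx hy /ginj; exact: finj.
- by move=> k k' p q hp hq /ginj e1 /ginj e2; exact: funiq e1 e2.
- by rewrite -eVW.
Qed.

(** The pairs of a block and an arc of [A] map injectively to the pairs of distinct points. Both
    sets have the same size, so the map is onto. *)
Lemma decomposable_arc A (V : finType) (I : finType) (f : I -> nat -> V) :
  arcs_ok A ->
  (forall k, {in gtn 7 &, injective (f k)}) ->
  (forall k k' p q, p \in A -> q \in A ->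
     f k p.1 = f k' q.1 -> f k p.2 = f k' q.2 -> k = k') ->
  #|I| * 7 = #|V| * #|V|.-1 ->
  forall x y, x != y -> exists k, exists2 p, p \in A & (f k p.1, f k p.2) = (x, y).
Proof.
move=> okA finj funiq fcard x y nxy.
pose h (u : I * seq_sub A) : V * V := (f u.1 (val u.2).1, f u.1 (val u.2).2).
have hinj : injective h.
  move=> [k p] [k' q] [/= e1 e2].
  have ek : k = k' by apply: funiq e1 e2; exact: valP.
  subst k'; congr pair; apply: val_inj.
  have [p1 p2 _] := arcs_ok_bounds _ _ okA (valP p).
  have [q1 q2 _] := arcs_ok_bounds _ _ okA (valP q).
  move/(finj _ _ _ p1 q1): e1; move/(finj _ _ _ p2 q2): e2.
  by case: (val p) (val q) => [a b] [c d] /= -> ->.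
have hsub : codom h \subset [pred p : V * V | p.1 != p.2].
  apply/subsetP => _ /codomP [[k p] ->]; rewrite !inE /=.
  have [p1 p2 np] := arcs_ok_bounds _ _ okA (valP p).
  by apply: contra np => /eqP /(finj _ _ _ p1 p2) ->.
have hcard : #|codom h| = #|[pred p : V * V | p.1 != p.2]|.
  rewrite card_codom // card_prod card_neq_pairs -fcard card_seq_sub.
    by case/and3P: okA => _ /eqP ->.
  by case/and3P: okA.
have := subset_cardP hcard hsub (x, y).
rewrite !inE /= nxy => /codomP [[k p] /= e].
by exists k, (val p); [exact: valP | rewrite e].
Qed.

(** * Passage to [has_decomposition], and necessity *)

Lemma mem_D_arcs i (e : 'I_7 * 'I_7) :
  1 <= i <= 10 -> (e \in D_arcs i) = ((val e.1, val e.2) \in D_arcs_nat i).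
Proof.
move=> /D_arcs_nat_ok ok; rewrite inE; apply/mapP/idP => [[p hp ->] | he].
  have [p1 p2 _] := arcs_ok_bounds _ _ ok hp.
  by rewrite /= !inordK //; case: p hp {p1 p2}.
by exists (val e.1, val e.2) => //=; case: e {he} => a b /=; rewrite !inord_val.
Qed.

Lemma decomposable_has_decomposition i v D :
  1 <= i <= 10 -> digraph_iso7 (D_arcs i) D ->
  decomposable (D_arcs_nat i) 'I_v -> has_decomposition v D.
Proof.
move=> hi [s ->] [I [f [finj funiq fcard]]].
have ok := D_arcs_nat_ok _ hi.
(* [s] carries [D_i] to the given digraph, so [s^-1] brings its vertices back to the labels on which
   [f k] acts. *)
pose g k : {ffun 'I_7 -> 'I_v} := [ffun j => f k (val ((s^-1)%g j))].
have memg k a : reflect (exists2 p, p \in D_arcs_nat i & (f k p.1, f k p.2) = a)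
    (a \in copy_arcs [set (s b.1, s b.2) | b in D_arcs i] (g k)).
  apply: (iffP imsetP) => [[_ /imsetP [b hb ->] ->] | [p hp <-]].
    exists (val b.1, val b.2); first by rewrite -mem_D_arcs.
    by rewrite !ffunE /= !permK.
  have [p1 p2 _] := arcs_ok_bounds _ _ ok hp.
  exists (s (Ordinal p1), s (Ordinal p2)); last by rewrite !ffunE /= !permK.
  apply/imsetP; exists (Ordinal p1, Ordinal p2) => //.
  by rewrite mem_D_arcs //=; case: p hp {p1 p2}.
exists [seq g k | k <- enum I]; split.
  move=> _ /mapP [k _ ->] x y; rewrite !ffunE => /finj e.
  by apply: (@perm_inj _ (s^-1)%g); apply: val_inj; apply: e; exact: ltn_ord.
case=> x y nxy; rewrite count_map.
have [k [p hp e]] := decomposable_arc _ _ _ _ ok finj funiq fcard x y nxy.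
rewrite (@eq_count _ _ (pred1 k)); last first.
  move=> k' /=; apply/memg/eqP => [[q hq] | ->]; last by exists p.
  by rewrite -e => -[e1 e2]; exact: funiq hq hp e1 e2.
by rewrite count_uniq_mem ?enum_uniq // mem_enum.
Qed.

(** Double counting of incidences between arcs and blocks: each block contributes 7, each pair of
    distinct points is covered once, and loops never occur. *)
Lemma has_decomposition_dvd i v D :
  1 <= i <= 10 -> digraph_iso7 (D_arcs i) D -> has_decomposition v D ->
  7 %| v * v.-1.
Proof.
move=> hi [s ->] [F [Finj Fcount]]; set D' := [set _ | _ in _] in Fcount.
have ok := D_arcs_nat_ok _ hi.
have cardD : #|D_arcs i| = 7.
  have /and3P [uA /eqP sA /allP hA] := ok.
  rewrite cardsE /D_arcs (card_uniqP _) ?size_map //.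
  rewrite map_inj_in_uniq // => p q /hA /and3P [p1 p2 _] /hA /and3P [q1 q2 _] [].
  move=> /(congr1 val) /=; rewrite !inordK // => e1.
  move=> /(congr1 val) /=; rewrite !inordK // => e2.
  by case: p q e1 e2 {p1 p2 q1 q2} => [a b] [c d] /= -> ->.
have cardD' : #|D'| = 7.
  by rewrite card_imset // => -[a b] [c d] [/perm_inj -> /perm_inj ->].
have cardF f : f \in F -> #|copy_arcs D' f| = 7.
  move=> /Finj finj; rewrite card_imset // => -[a b] [c d] [/finj -> /finj ->] //.
have loopF f x : f \in F -> (x, x) \in copy_arcs D' f = false.
  move=> /Finj finj; apply/negP => /imsetP [_ /imsetP [b hb ->] [-> /finj /perm_inj e]].
  move: hb; rewrite mem_D_arcs // => /(arcs_ok_bounds _ _ ok) [_ _] /=.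
  by rewrite e eqxx.
have <- : \sum_(f <- F) #|copy_arcs D' f| = v * v.-1.
  rewrite -[v in RHS]card_ord -card_neq_pairs -sum1_card.
  rewrite [RHS](eq_bigr (fun a => count (fun f => a \in copy_arcs D' f) F)); last first.
    by move=> a ha; rewrite Fcount.
  under [RHS]eq_bigr do rewrite -sum1_count big_mkcond.
  rewrite [RHS]exchange_big /= big_seq [RHS]big_seq; apply: eq_bigr => f hf.
  rewrite -sum1_card big_mkcond [RHS]big_mkcond; apply: eq_bigr => -[x y] _ /=.
  rewrite inE /=; case: (eqVneq x y) => [->|_] //=; by rewrite loopF.
rewrite big_seq (eq_bigr (fun=> 7)) => [|f /cardF //].
by apply: dvdn_sum.
Qed.

(** * Idempotent Latin squares of every order at least 3 *)

(* The rows [(x, y, z(x,y))], [x <> y], of an idempotent Latin square [z] on [T]: in any two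
   of the three columns every ordered pair of distinct elements occurs exactly once. *)
Definition transversal_family (T : finType) : Prop :=
  exists (B : finType) (pt : B -> nat -> T),
    [/\ forall b, {in gtn 3 &, injective (pt b)},
        forall b b' c d, c < 3 -> d < 3 -> c != d ->
          pt b c = pt b' c -> pt b d = pt b' d -> b = b'
      & #|B| = #|T| * #|T|.-1].

(** The third column is [op]: [idem] separates it from the other two, and cancellation on either
    side recovers [(x, y)] from [op x y] and one argument. *)
Lemma transversal_family_op (T : finType) (op : T -> T -> T) :
  (forall x y, x != y -> op x y != x /\ op x y != y) ->
  (forall x y y', op x y = op x y' -> y = y') ->
  (forall x x' y, op x y = op x' y -> x = x') ->
  transversal_family T.
Proof.
move=> idem injr injl.
pose pt (b : {p : T * T | p.1 != p.2}) c :=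
  match c with 0 => (val b).1 | 1 => (val b).2 | _ => op (val b).1 (val b).2 end.
exists {p : T * T | p.1 != p.2}, pt; split.
- move=> [[x y] /= nxy]; have [nx ny] := idem _ _ nxy.
  have lt3 (c : nat) : c \in gtn 3 -> [\/ c = 0, c = 1 | c = 2].
    by case: c => [|[|[|c]]] // _; [constructor 1 | constructor 2 | constructor 3].
  move=> c d /lt3 [] -> /lt3 [] -> //= /eqP; rewrite ?[x == _]eq_sym ?[y == op _ _]eq_sym;
    by rewrite 1?(negPf nx) 1?(negPf ny) 1?[y == x]eq_sym 1?(negPf nxy).
- move=> [[x y] /= nxy] [[x' y'] /= nxy'] c d hc hd ncd e1 e2; apply: val_inj => /=.
  move: c d hc hd ncd e1 e2.
  move=> [|[|[|c]]] [|[|[|d]]] //= _ _ _; rewrite /pt /=.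
  + by move=> -> ->.
  + by move=> -> /injr ->.
  + by move=> -> ->.
  + by move=> -> /injl ->.
  + by move=> e ex; move: e; rewrite ex => /injr ->.
  + by move=> e ey; move: e; rewrite ey => /injl ->.
- by rewrite card_sig card_neq_pairs.
Qed.

Section OddLatinSquare.
Local Open Scope ring_scope.
Import GRing.Theory.
Context (T : finZmodType) (g : T).
Context (dbl_inj : injective (fun x : T => x + x)) (g_neq0 : g != 0).

(** [2x - y] gives an idempotent Latin square as soon as doubling is injective. *)
Definition odd_op (x y : T) : T := x + x - y.

Lemma odd_op_idem x y : x != y -> odd_op x y != x /\ odd_op x y != y.
Proof.
move=> nxy; split; apply: contra nxy.
  by rewrite /odd_op -addrA -[X in _ == X]addr0 (inj_eq (addrI x)) subr_eq0.
by rewrite /odd_op subr_eq => /eqP /dbl_inj ->.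
Qed.

Lemma odd_op_injr x y y' : odd_op x y = odd_op x y' -> y = y'.
Proof. by move=> /addrI /oppr_inj. Qed.

Lemma odd_op_injl x x' y : odd_op x y = odd_op x' y -> x = x'.
Proof. by move=> /addIr /dbl_inj. Qed.

(* Prolongation: the cells [(x, x + g)] form a transversal, which is moved to the new
   row and column. *)
Definition even_op (x y : option T) : option T :=
  match x, y with
  | Some a, Some b => if b == a + g then None else Some (odd_op a b)
  | Some a, None => Some (a - g)
  | None, Some b => Some (b - g - g)
  | None, None => None
  end.

Lemma even_op_idem x y : x != y -> even_op x y != x /\ even_op x y != y.
Proof.
(* The entry [b - 2g] in row [None] has to differ from its column [b]. *)
have g2 : - g - g != 0.
  rewrite -opprD oppr_eq0; apply: contra g_neq0 => /eqP e.
  by apply/eqP; apply: dbl_inj; rewrite e addr0.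
case: x y => [a|] [b|] //= nab.
- by case: (eqVneq b (a + g)) => // _; exact: (odd_op_idem a b nab).
- split=> //; apply: contra g_neq0 => e; have {e} : a - g == a + 0 by rewrite addr0.
  by rewrite (inj_eq (addrI a)) oppr_eq0.
- split=> //; apply: contra g2 => e; have {e} : b + (- g - g) == b + 0 by rewrite addr0 addrA.
  by rewrite (inj_eq (addrI b)).
Qed.

(** The entry removed from row [a] is the one moved to column [None]; the next lemma is the same by
    columns. Cancellation for [odd_op] thus also compares moved entries with ordinary ones. *)
Lemma odd_op_shift a : odd_op a (a + g) = a - g.
Proof. by rewrite /odd_op opprD addrA addrK. Qed.

Lemma odd_op_shiftl b : odd_op (b - g) b = b - g - g.
Proof. by rewrite /odd_op addrC !addrA addNr add0r [- g + b]addrC. Qed.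

Lemma even_op_injr x y y' : even_op x y = even_op x y' -> y = y'.
Proof.
case: x y y' => [a|] [b|] [b'|] //=.
- case: eqP => [->|_]; case: eqP => [->|_] // [].
  by move/odd_op_injr ->.
- by case: eqP => // nb [] /=; rewrite -odd_op_shift => /odd_op_injr.
- by case: eqP => // nb [] /=; rewrite -odd_op_shift => /odd_op_injr /esym.
- by move=> [] /addIr /addIr ->.
Qed.

Lemma even_op_injl x x' y : even_op x y = even_op x' y -> x = x'.
Proof.
case: x x' y => [a|] [a'|] [b|] //=.
- case: (b =P a + g) => [->|_]; case: (_ =P a' + g) => [e|_] //.
    by rewrite (addIr _ e).
  by move=> [] /odd_op_injl ->.
- by move=> [] /addIr ->.
- case: eqP => // nb [] /=; rewrite -odd_op_shiftl => /odd_op_injl e.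
  by case: nb; rewrite e subrK.
- case: eqP => // nb [] /=; rewrite -odd_op_shiftl => /odd_op_injl e.
  by case: nb; rewrite -e subrK.
Qed.

Lemma transversal_family_odd : transversal_family T.
Proof. exact: transversal_family_op odd_op_idem odd_op_injr odd_op_injl. Qed.

Lemma transversal_family_even : transversal_family (option T).
Proof. exact: transversal_family_op even_op_idem even_op_injr even_op_injl. Qed.

End OddLatinSquare.

Lemma Zp_double_inj n : odd n.+1 -> injective (fun x : 'I_n.+1 => x + x)%R.
Proof.
move=> on x y /(congr1 val) /= e; apply: val_inj.
wlog lexy : x y e / y <= x.
  by move=> hw; case: (leqP y x) => [|/ltnW] le; [|symmetry]; apply: hw le.
move/eqP: e; rewrite !addnn -!muln2 eqn_mod_dvd ?leq_mul // -mulnBl.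
rewrite Gauss_dvdl ?coprimen2 // => /dvdnP [[|k] ek]; first by rewrite /=; lia.
by have := ltn_ord x; rewrite /=; nia.
Qed.

(** The cyclic group of order [t] serves odd [t]; prolonging the square of order [t - 1], with
    [g = 1], serves even [t]. *)
Lemma exists_transversal_family t :
  3 <= t -> exists2 T : finType, #|T| = t & transversal_family T.
Proof.
have g_neq0 n : (inZp 1 : 'I_n.+2) != 0%R by [].
case: (boolP (odd t)) => [|ev].
  case: t => [|[|t]] // ot _; exists 'I_t.+2; first by rewrite card_ord.
  exact: transversal_family_odd (Zp_double_inj _ ot).
case: t ev => [|[|[|t]]] // ev _; exists (option 'I_t.+2).
  by rewrite card_option card_ord.
apply: (transversal_family_even _ (inZp 1)) (g_neq0 t).
by apply: Zp_double_inj; move: ev; rewrite /= negbK.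
Qed.

(** * The product construction *)

Definition block_arcs (A : seq (nat * nat)) (b : seq nat) : seq (nat * nat) :=
  [seq (nth 0 b p.1, nth 0 b p.2) | p <- A].

(** The quotient of a label by 7 is its part, the remainder its element of Z_7. The last clause
    lists the differences, head minus tail; [7 - _] avoids truncated subtraction. *)
Definition transversal_cycle (A : seq (nat * nat)) (w : seq nat) : bool :=
  [&& uniq w, size w == 7, all (gtn 21) w,
      all (fun p => p.1 %/ 7 != p.2 %/ 7) (block_arcs A w)
    & uniq [seq (p.2 + (7 - p.1 %% 7)) %% 7 | p <- block_arcs A w]].

(** [E] holds the extra point, if any. Blocks are of two kinds: translates of [w] across three
    parts, and blocks filling a hole. *)
Lemma decomposable_product A w (T E : finType) :
  arcs_ok A -> transversal_cycle A w -> transversal_family T -> #|E| <= 1 ->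
  decomposable A ('I_7 + E)%type -> decomposable A (T * 'I_7 + E)%type.
Proof.
move=> ok /and5P [uw /eqP sw /allP w21 /allP wcol wdiff] [B [pt [ptinj ptuniq cardB]]] E1.
move=> [J [h [hinj huniq cardJ]]].
have Eeq (x y : E) : x = y.
  by apply/eqP; move: E1; rewrite leqNgt; apply: contraNT => nxy;
     rewrite (cardD1 x) (cardD1 y) !inE eq_sym nxy.
pose fill t (x : 'I_7 + E) : T * 'I_7 + E :=
  match x with inl c => inl (t, c) | inr e => inr e end.
have fill_inj t : injective (fill t).
  by move=> [c|e] [c'|e'] //= [->].
pose f (k : B * 'I_7 + T * J) j : T * 'I_7 + E :=
  match k with
  | inl (b, c) => inl (pt b (nth 0 w j %/ 7), inZp (nth 0 w j + c))
  | inr (t, l) => fill t (h l j)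
  end.
have nthw j : j < 7 -> nth 0 w j < 21.
  by move=> hj; apply: w21; rewrite mem_nth ?sw.
have col3 j : j < 7 -> nth 0 w j %/ 7 < 3.
  by move=> /nthw; rewrite ltn_divLR.
have colA p : p \in A -> nth 0 w p.1 %/ 7 != nth 0 w p.2 %/ 7.
  by move=> hp; apply: (wcol (_, _)); apply/mapP; exists p.
exists (B * 'I_7 + T * J)%type, f; split.
- move=> [[b c]|[t l]] x y hx hy /=; last by move=> /fill_inj; exact: hinj.
  move=> [] /(ptinj _ _ _ (col3 _ hx) (col3 _ hy)) ec ev.
  have em : nth 0 w x %% 7 = nth 0 w y %% 7 by lia.
  apply/eqP; rewrite -(nth_uniq 0 _ _ uw) ?sw //.
  by apply/eqP; rewrite (divn_eq (nth 0 w x) 7) ec em -divn_eq.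
- move=> k k' p q hp hq.
  have [p1 p2 np] := arcs_ok_bounds _ _ ok hp.
  have [q1 q2 nq] := arcs_ok_bounds _ _ ok hq.
  (* An arc of a translate joins two different parts, whereas an arc of a hole block that avoids the
     extra point stays within one. *)
  have mixed b c t l u v : u \in A -> v \in A ->
      f (inl (b, c)) u.1 = f (inr (t, l)) v.1 ->
      f (inl (b, c)) u.2 = f (inr (t, l)) v.2 -> False.
    move=> hu hv /=.
    have [u1 u2 _] := arcs_ok_bounds _ _ ok hu.
    case: (h l v.1) => // c1; case: (h l v.2) => // c2 /= [e1 _] [e2 _].
    have := colA _ hu; rewrite -(inj_in_eq (ptinj b)) ?inE ?col3 //.
    by rewrite e1 e2 eqxx.
  case: k k' => [[b c]|[t l]] [[b' c']|[t' l']].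
  + move=> [e1 v1] [e2 v2].
    (* The translation cancels in the difference of the endpoints, which therefore identifies the
       arc of [A]. *)
    have epq : p = q.
      pose d (r : nat * nat) := (nth 0 w r.2 + (7 - nth 0 w r.1 %% 7)) %% 7.
      have dinj : {in A &, injective d}.
        by apply: uniq_map_inj_in; rewrite -map_comp in wdiff.
      by apply: dinj => //; rewrite /d; lia.
    subst q.
    have -> : b = b' by apply: ptuniq e1 e2; rewrite ?col3 // colA.
    by congr (inl (_, _)); apply: val_inj => /=; have := ltn_ord c; have := ltn_ord c'; lia.
  + by move=> e1 e2; case: (mixed _ _ _ _ _ _ hp hq e1 e2).
  + by move=> e1 e2; case: (mixed _ _ _ _ _ _ hq hp (esym e1) (esym e2)).
  + move=> /= e1 e2.
    (* The ends of an arc are distinct, so at most one is the extra point; the other determines the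
       hole. *)
    have et : t = t'.
      case E1h : (h l p.1) e1 => [c1|x1].
        by case: (h l' q.1) => [c1'|?] //= [].
      case E2h : (h l p.2) e2 => [c2|x2].
        by case: (h l' q.2) => [c2'|?] //= [].
      case/negP: np; apply/eqP; apply: (hinj l) => //.
      by rewrite E1h E2h (Eeq x1 x2).
    subst t'; move/fill_inj: e1; move/fill_inj: e2 => e2 e1.
    by rewrite (huniq _ _ _ _ hp hq e1 e2).
(* For [e = #|E|] in {0, 1} and [t = #|T|]: [(7t + e)(7t + e - 1) = 49t(t - 1) + t(7 + e)(6 +
   e)]. *)
- move: cardJ; rewrite !card_sum !card_prod cardB !card_ord => cardJ.
  move: E1; case: #|E| cardJ => [|[|//]] /=; case: #|T| => [|t] /=; nia.
Qed.

(** * Small orders, by explicit designs *)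

Definition develop (v n : nat) (starters : seq (seq nat)) : seq (seq nat) :=
  [seq [seq if x %/ n < v %/ n then x %/ n * n + (x + c) %% n else x | x <- b]
     | c <- iota 0 n, b <- starters].

(** A boolean counterpart of [decomposable] on lists, so that designs can be checked by
    evaluation. *)
Definition block_design (A : seq (nat * nat)) (v : nat) (bs : seq (seq nat)) : bool :=
  [&& all (fun b => [&& uniq b, size b == 7 & all (gtn v) b]) bs,
      pairwise (fun b b' => ~~ has (mem (block_arcs A b)) (block_arcs A b')) bs
    & size bs * 7 == v * v.-1].

Lemma decomposable_block_design A v bs :
  0 < v -> arcs_ok A -> block_design A v bs -> decomposable A 'I_v.
Proof.
case: v => // v _ ok /and3P [/allP wf /(pairwiseP [::]) pw /eqP cardbs].
pose f (k : 'I_(size bs)) j : 'I_v.+1 := inord (nth 0 (nth [::] bs k) j).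
have wfk (k : 'I_(size bs)) :
    [&& uniq (nth [::] bs k), size (nth [::] bs k) == 7 & all (gtn v.+1) (nth [::] bs k)].
  by apply: wf; rewrite mem_nth.
have fE k j : j < 7 -> val (f k j) = nth 0 (nth [::] bs k) j.
  move=> hj; case/and3P: (wfk k) => _ /eqP sb /allP hb.
  by rewrite /= inordK //; apply: hb; rewrite mem_nth ?sb.
exists 'I_(size bs), f; split; last by rewrite !card_ord.
- move=> k x y hx hy /(congr1 val); rewrite !fE // => /eqP.
  by case/and3P: (wfk k) => ub /eqP sb _; rewrite nth_uniq ?sb // => /eqP.
(* [pairwise] compares a block only with later ones; symmetry gives the rest. *)
- have lt (k k' : 'I_(size bs)) p q : k < k' -> p \in A -> q \in A ->
      f k p.1 = f k' q.1 -> f k p.2 = f k' q.2 -> False.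
    move=> ltk hp hq; have [p1 p2 _] := arcs_ok_bounds _ _ ok hp.
    have [q1 q2 _] := arcs_ok_bounds _ _ ok hq.
    move=> /(congr1 val); rewrite !fE // => e1 /(congr1 val); rewrite !fE // => e2.
    have /negP := pw k k' (ltn_ord k) (ltn_ord k') ltk; apply; apply/hasP.
    exists (nth 0 (nth [::] bs k') q.1, nth 0 (nth [::] bs k') q.2).
      by apply/mapP; exists q.
    by rewrite -e1 -e2; apply/mapP; exists p.
  move=> k k' p q hp hq e1 e2; apply: val_inj; case: (ltngtP k k') => // ltk.
    by case: (lt _ _ _ _ ltk hp hq e1 e2).
  by case: (lt _ _ _ _ ltk hq hp (esym e1) (esym e2)).
Qed.

(* Entry [i - 1], for D_i, is a triple [(n, starters, fixed)]: the blocks are the [starters],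
   developed by translation in each full interval [[kn, (k+1)n)] of points (leftover points
   being fixed), together with the [fixed] blocks. *)
Definition small_designs (v : nat) : seq (nat * seq (seq nat) * seq (seq nat)) :=
  match v with
  | 7 => [::
      (6, [:: [:: 0; 3; 1; 2; 6; 5; 4]], [::]);
      (6, [:: [:: 0; 6; 3; 2; 4; 1; 5]], [::]);
      (6, [:: [:: 0; 4; 5; 2; 6; 3; 1]], [::]);
      (6, [:: [:: 0; 2; 1; 4; 3; 5; 6]], [::]);
      (6, [:: [:: 0; 6; 5; 1; 2; 4; 3]], [::]);
      (6, [:: [:: 0; 6; 3; 4; 2; 5; 1]], [::]);
      (6, [:: [:: 0; 5; 2; 4; 6; 3; 1]], [::]);
      (6, [:: [:: 0; 2; 3; 5; 4; 1; 6]], [::]);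
      (6, [:: [:: 0; 6; 1; 2; 5; 3; 4]], [::]);
      (6, [:: [:: 0; 3; 2; 4; 6; 1; 5]], [::])]
  | 8 => [::
      (8, [:: [:: 0; 6; 7; 4; 2; 1; 5]], [::]);
      (8, [:: [:: 0; 5; 6; 4; 1; 3; 7]], [::]);
      (8, [:: [:: 0; 1; 7; 4; 6; 2; 3]], [::]);
      (8, [:: [:: 0; 6; 7; 5; 1; 4; 3]], [::]);
      (8, [:: [:: 0; 1; 3; 2; 5; 7; 4]], [::]);
      (8, [:: [:: 0; 1; 4; 7; 3; 5; 6]], [::]);
      (8, [:: [:: 0; 2; 7; 6; 1; 3; 4]], [::]);
      (8, [:: [:: 0; 7; 4; 1; 3; 2; 6]], [::]);
      (8, [:: [:: 0; 3; 1; 2; 6; 4; 5]], [::]);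
      (7, [:: [:: 0; 4; 3; 5; 1; 6; 7]], [:: [:: 0; 1; 2; 3; 4; 5; 6]])]
  | 14 => [::
      (13, [:: [:: 0; 11; 7; 4; 10; 8; 9]; [:: 0; 1; 13; 3; 8; 11; 6]], [::]);
      (13, [:: [:: 0; 6; 3; 9; 10; 2; 13]; [:: 0; 9; 11; 7; 6; 3; 5]], [::]);
      (13, [:: [:: 0; 7; 4; 9; 10; 13; 11]; [:: 0; 6; 11; 12; 3; 1; 10]], [::]);
      (13, [:: [:: 0; 1; 4; 12; 3; 5; 2]; [:: 0; 9; 10; 2; 8; 1; 13]], [::]);
      (13, [:: [:: 0; 12; 2; 10; 4; 6; 9]; [:: 0; 7; 11; 12; 10; 13; 5]], [::]);
      (13, [:: [:: 0; 11; 5; 4; 12; 8; 13]; [:: 0; 6; 8; 9; 12; 7; 4]], [::]);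
      (13, [:: [:: 0; 2; 9; 7; 8; 4; 5]; [:: 0; 8; 12; 9; 13; 4; 7]], [::]);
      (13, [:: [:: 0; 3; 8; 7; 5; 11; 2]; [:: 0; 4; 3; 6; 1; 8; 13]], [::]);
      (13, [:: [:: 0; 7; 10; 6; 5; 9; 2]; [:: 0; 13; 10; 12; 2; 3; 8]], [::]);
      (7, [:: [:: 0; 12; 1; 9; 3; 7; 10]; [:: 0; 9; 8; 1; 11; 13; 5]; [:: 0; 13; 4; 3; 10; 7; 12]],
       [:: [:: 7; 8; 9; 10; 11; 12; 13]; [:: 0; 1; 2; 3; 4; 5; 6]; [:: 0; 3; 6; 2; 5; 1; 4];
           [:: 0; 4; 1; 5; 2; 6; 3]; [:: 0; 5; 3; 1; 6; 4; 2]])]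
  | 15 => [::
      (15, [:: [:: 0; 7; 10; 12; 3; 1; 11]; [:: 0; 8; 9; 3; 14; 11; 10]], [::]);
      (15, [:: [:: 0; 3; 12; 10; 9; 11; 14]; [:: 0; 10; 3; 7; 2; 11; 4]], [::]);
      (15, [:: [:: 0; 12; 11; 4; 14; 1; 9]; [:: 0; 14; 10; 6; 4; 13; 3]], [::]);
      (15, [:: [:: 0; 14; 11; 9; 3; 13; 6]; [:: 0; 10; 14; 6; 3; 5; 4]], [::]);
      (15, [:: [:: 0; 2; 12; 3; 4; 11; 7]; [:: 0; 13; 3; 12; 9; 8; 11]], [::]);
      (15, [:: [:: 0; 3; 7; 2; 6; 12; 10]; [:: 0; 7; 1; 8; 10; 11; 14]], [::]);
      (15, [:: [:: 0; 14; 10; 4; 13; 12; 5]; [:: 0; 7; 5; 2; 14; 1; 11]], [::]);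
      (15, [:: [:: 0; 1; 6; 10; 14; 11; 2]; [:: 0; 14; 12; 5; 13; 1; 10]], [::]);
      (15, [:: [:: 0; 1; 8; 9; 6; 11; 2]; [:: 0; 8; 5; 1; 11; 2; 13]], [::]);
      (15, [:: [:: 0; 3; 2; 6; 12; 9; 10]; [:: 0; 11; 9; 4; 6; 14; 8]], [::])]
  | _ => [::]
  end.

(** One evaluation checks all forty designs. The fixed blocks, used only for [D_10], are directed
    cycles of constant difference modulo 7; translation preserves them, so they are not
    developed. *)
Lemma decomposable_small i v :
  1 <= i <= 10 -> v \in [:: 7; 8; 14; 15] -> decomposable (D_arcs_nat i) 'I_v.
Proof.
move=> hi hv.
pose design i v := let: (n, starters, fixed) := nth (0, [::], [::]) (small_designs v) i.-1 in
  develop v n starters ++ fixed.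
have /allP /(_ v hv) /allP /(_ i) : all (fun v => all (fun i =>
    block_design (D_arcs_nat i) v (design i v)) (iota 1 10)) [:: 7; 8; 14; 15].
  by vm_compute.
rewrite mem_iota => /(_ hi); apply: decomposable_block_design.
  by move: hv; rewrite !inE => /or4P [] /eqP ->.
exact: D_arcs_nat_ok.
Qed.

(** * Cycles across three parts, and the assembly of all orders *)

(* Label [7 * c + x] stands for the point [x] of the [c]-th part of K*_{7,7,7}. *)
Definition transversal_cycles : seq (seq nat) := [::
  [:: 0; 7; 1; 10; 2; 12; 16];
  [:: 0; 8; 14; 2; 7; 17; 10];
  [:: 0; 8; 1; 7; 2; 12; 16];
  [:: 0; 8; 1; 10; 2; 7; 17];
  [:: 0; 8; 1; 7; 2; 12; 16];
  [:: 0; 7; 1; 10; 6; 12; 16];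
  [:: 0; 7; 1; 10; 2; 12; 17];
  [:: 0; 7; 1; 10; 2; 12; 16];
  [:: 0; 7; 1; 10; 6; 11; 17];
  [:: 0; 7; 1; 10; 2; 12; 16]].

Lemma transversal_cyclesP i :
  1 <= i <= 10 -> transversal_cycle (D_arcs_nat i) (nth [::] transversal_cycles i.-1).
Proof. by do 11 (case: i => [|i] //); vm_compute. Qed.

Lemma decomposable_of_mod i v :
  1 <= i <= 10 -> 7 <= v -> v %% 7 = 0 \/ v %% 7 = 1 ->
  decomposable (D_arcs_nat i) 'I_v.
Proof.
move=> hi v7 hv; have ok := D_arcs_nat_ok _ hi.
case: (boolP (v \in [:: 7; 8; 14; 15])) => [|big]; first exact: decomposable_small.
have ev := divn_eq v 7; set t := v %/ 7 in ev.
(* Order 2 admits no idempotent Latin square, hence the direct designs for 14 and 15. *)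
have t3 : 3 <= t by move: big; rewrite !inE; lia.
have [T cardT famT] := exists_transversal_family _ t3.
have product := decomposable_product _ _ T _ ok (transversal_cyclesP _ hi) famT.
case: hv => hv; rewrite hv in ev.
- apply: (decomposable_card _ (T * 'I_7 + void)%type) => //.
    by rewrite card_sum card_prod cardT !card_ord card_void ev.
  apply: product; first by rewrite card_void.
  apply: (decomposable_card _ 'I_7) => //; last exact: decomposable_small.
  by rewrite card_sum card_void !card_ord.
- apply: (decomposable_card _ (T * 'I_7 + unit)%type) => //.
    by rewrite card_sum card_prod cardT !card_ord card_unit ev.
  apply: product; first by rewrite card_unit.
  apply: (decomposable_card _ 'I_8) => //; last exact: decomposable_small.
  by rewrite card_sum card_unit !card_ord.
Qed.

Theorem theorem3p7 (D : {set 'I_7 * 'I_7}) (v : nat) :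
  (exists2 i, 1 <= i <= 10 & digraph_iso7 (D_arcs i) D) ->
  7 <= v ->
  has_decomposition v D <-> (v %% 7 = 0 \/ v %% 7 = 1).
Proof.
move=> [i hi iso] v7; split=> [/(has_decomposition_dvd _ _ _ hi iso) | hv].
  rewrite Euclid_dvdM // => /orP []; first by move/eqP; left.
  by move=> h; right; move: h v7; case: v => [|v] //= /dvdnP [q ->]; lia.
exact: decomposable_has_decomposition hi iso (decomposable_of_mod _ _ hi v7 hv).
Qed.
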